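(* Let $m\ge 1$ and, for each unit $i\in[m]=\{1,\dots,m\}$, let $n_i\ge 2$ observations be generated as $X_{ij}=\mu_i+\epsilon_{ij}$, $j\in[n_i]$, where $\mu_i$ is an unknown constant and $\mathbb{E}(\epsilon_{ij})=0$. Let $\mathcal{H}_0=\{i\in[m]:\mu_i=0\}$ and write $\mathbf{X}_i=(X_{ij}:j\in[n_i])$. Assume that for every $i\in\mathcal{H}_0$ the errors $\{\epsilon_{ij}:j\in[n_i]\}$ are i.i.d. conditional on $(\mathbf{X}_1,\dots,\mathbf{X}_{i-1},\mathbf{X}_{i+1},\dots,\mathbf{X}_m)$, with a conditional density $f_i^{\epsilon}(\cdot\mid \mathbf{X}_1,\dots,\mathbf{X}_{i-1},\mathbf{X}_{i+1},\dots,\mathbf{X}_m)$ that is symmetric about zero, i.e. $f_i^{\epsilon}(-x\mid\cdot)=f_i^{\epsilon}(x\mid\cdot)$ for all $x$. Construct $(T_i,T_i^0)$, $i\in[m]$, as follows. Randomly (independently of the data) partition $[n_i]$ into $\mathcal{N}_{i1},\mathcal{N}_{i2}$ with $n_{i1}=|\mathcal{N}_{i1}|=\lceil n_i/2\rceil$ and $n_{i2}=n_i-n_{i1}$. Let $\bar X_{ik}=n_{ik}^{-1}\sum_{j\in\mathcal{N}_{ik}}X_{ij}$ and $S_{ik}^2=(n_{ik}-1)^{-1}\sum_{j\in\mathcal{N}_{ik}}(X_{ij}-\bar X_{ik})^2$ for $k=1,2$ (whenever $n_{ik}\ge 2$). Set $V_i=\bar X_{i1}+\bar X_{i2}$, $V_i^0=\bar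 X_{i1}-\bar X_{i2}$. - If $n_i\ge 4$: $S_i=\sqrt{\frac{n_i}{n_{i1}n_{i2}}\cdot\frac{(n_{i1}-1)S_{i1}^2+(n_{i2}-1)S_{i2}^2}{n_i-2}}$ and $T_i=\Phi^{-1}\{G_{t,n_i-2}(V_i/S_i)\}$, $T_i^0=\Phi^{-1}\{G_{t,n_i-2}(V_i^0/S_i)\}$. - If $n_i=3$: the same formulas for $T_i,T_i^0$ with $S_i$ replaced by $S_{i1}$. - If $n_i=2$: $T_i=(X_{i1}+X_{i2})/\sqrt2$ and $T_i^0=(X_{i1}-X_{i2})/\sqrt2$. Here $\Phi$ is the standard normal CDF and $G_{t,\nu}$ the CDF of the $t$-distribution with $\nu$ degrees of freedom. Then the pairs are pairwise exchangeable under the null: for every $i\in\mathcal{H}_0$, $$(T_i,T_i^0\mid \mathbf{T}_{-i},\mathbf{T}^0_{-i})\stackrel{d}{=}(T_i^0,T_i\mid \mathbf{T}_{-i},\mathbf{T}^0_{-i}),$$ where $\mathbf{T}_{-i}=(T_1,\dots,T_{i-1},T_{i+1},\dots,T_m)$ and $\mathbf{T}^0_{-i}=(T^0_1,\dots,T^0_{i-1},T^0_{i+1},\dots,T^0_m)$.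
   Context: $\stackrel{d}{=}$ denotes equality of (conditional) distributions. The random partitions are drawn independently of the data. *)

(* Defs.v *)
From HB Require Import structures.
From mathcomp Require Import all_boot all_order all_algebra.
From mathcomp Require Import all_classical all_reals all_analysis.
Set Implicit Arguments.
Unset Strict Implicit.
Unset Printing Implicit Defensive.
Import Order.TTheory GRing.Theory Num.Theory.
Import numFieldNormedType.Exports.
Local Open Scope classical_set_scope.
Local Open Scope ring_scope.

Definition Phi (R : realType) (x : R) : R :=
  \int[@lebesgue_measure R]_(u in [set u : R | u <= x])
     (expR (- (u ^+ 2) / 2) / Num.sqrt (2 * pi)).

(** Its inverse (Phi is a bijection R -> (0,1)); outside (0,1) the value is
    irrelevant (a default point). *)
Definition Phi_inv (R : realType) (p : R) : R := xget 0 [set x : R | Phi x = p].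

Definition t_kernel (R : realType) (nu : nat) (u : R) : R :=
  (1 + u ^+ 2 / nu%:R) `^ (- ((nu%:R + 1) / 2)).

Definition G_t (R : realType) (nu : nat) (x : R) : R :=
  (\int[@lebesgue_measure R]_(u in [set u : R | u <= x]) t_kernel nu u) /
  (\int[@lebesgue_measure R]_(u in [set: R]) t_kernel nu u).

Definition smean (R : realType) (n : nat) (x : nat -> R) (A : {set 'I_n}) : R :=
  (\sum_(j in A) x (val j)) / #|A|%:R.

Definition svar (R : realType) (n : nat) (x : nat -> R) (A : {set 'I_n}) : R :=
  (\sum_(j in A) (x (val j) - smean x A) ^+ 2) / (#|A|.-1)%:R.

(** The pair (T_i, T_i^0) built from the observations x_0, ..., x_{n-1}
    (0-based: x_0 = X_{i1}, x_1 = X_{i2}) of one unit and the first block N1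
    of the random split (the second block is its complement). *)
Definition stat_pair (R : realType) (n : nat) (x : nat -> R) (N1 : {set 'I_n})
  : R * R :=
  let N2 := ~: N1 in
  let n1 : R := #|N1|%:R in
  let n2 : R := #|N2|%:R in
  let V := smean x N1 + smean x N2 in
  let V0 := smean x N1 - smean x N2 in
  if n == 2%N then
    ((x 0%N + x 1%N) / Num.sqrt 2, (x 0%N - x 1%N) / Num.sqrt 2)
  else
    let S :=
      if n == 3%N then Num.sqrt (svar x N1)
      else Num.sqrt (n%:R / (n1 * n2) *
             (((n1 - 1) * svar x N1 + (n2 - 1) * svar x N2) / (n - 2)%:R)) in
    (Phi_inv (G_t (n - 2) (V / S)), Phi_inv (G_t (n - 2) (V0 / S))).

(** Observations X_{ij} = mu_i + eps_{ij} (only j < n_i is meaningful). *)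
Definition Xobs (R : realType) (T : Type) (m : nat) (mu : 'I_m -> R)
  (eps : 'I_m -> nat -> T -> R) (i : 'I_m) (j : nat) (w : T) : R :=
  mu i + eps i j w.

Definition Tst (R : realType) (T : Type) (m : nat) (n : 'I_m -> nat)
  (mu : 'I_m -> R) (eps : 'I_m -> nat -> T -> R)
  (N1 : forall i : 'I_m, T -> {set 'I_(n i)}) (i : 'I_m) (w : T) : R :=
  (stat_pair (fun j => Xobs mu eps i j w) (N1 i w)).1.

Definition T0st (R : realType) (T : Type) (m : nat) (n : 'I_m -> nat)
  (mu : 'I_m -> R) (eps : 'I_m -> nat -> T -> R)
  (N1 : forall i : 'I_m, T -> {set 'I_(n i)}) (i : 'I_m) (w : T) : R :=
  (stat_pair (fun j => Xobs mu eps i j w) (N1 i w)).2.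

Definition data_rect (R : realType) (T : Type) (m : nat) (n : 'I_m -> nat)
  (X : 'I_m -> nat -> T -> R) (keep : 'I_m -> bool) (B : 'I_m -> nat -> set R)
  : set T :=
  [set w | forall k j, keep k -> (j < n k)%N -> B k j (X k j w)].

(** (Y1, Y2 | W) =d (Z1, Z2 | W): equality of the conditional laws given the
    finite family W.  Since the conditioning variable is the same on both
    sides, this is equality of the joint laws of (Y1, Y2, W) and (Z1, Z2, W)
    on the product Borel sigma-algebra, which is determined by (and here
    written out on) the generating pi-system of measurable rectangles. *)
Definition cond_eq_dist (R : realType) (d : measure_display)
  (T : measurableType d) (P : probability T R) (Y1 Y2 Z1 Z2 : T -> R)
  (I : finType) (W : I -> T -> R) : Prop :=
  forall (A1 A2 : set R) (B : I -> set R),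
    measurable A1 -> measurable A2 -> (forall k, measurable (B k)) ->
    P [set w | A1 (Y1 w) /\ A2 (Y2 w) /\ forall k, B k (W k w)] =
    P [set w | A1 (Z1 w) /\ A2 (Z2 w) /\ forall k, B k (W k w)].

Definition cond_family (R : realType) (T : Type) (m : nat) (Tf T0f : 'I_m -> T -> R)
  (i : 'I_m) : ({k : 'I_m | k != i} * bool)%type -> T -> R :=
  fun kb => if kb.2 then Tf (val kb.1) else T0f (val kb.1).
Arguments cond_family {R T m} Tf T0f i _ _.

(* Main.v *)
(** Fix a value of the random splits and change the sign of the observations of
    the null unit i lying in its second block. The second mean changes sign while
    both sample variances are unchanged, so V and V^0, hence T_i and T_i^0, are
    exchanged, and the other units are untouched. Symmetry of the conditional
    density makes the joint law of all the data invariant under this sign change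
    on rectangles, hence on the generated sigma-algebra; one concludes by summing
    over the values of the splits, which are independent of the data. Since
    the statistics must be Borel functions of the data, one also needs that
    Phi_inv is: Phi is continuous and strictly increasing, so its range is an
    interval, on which Phi_inv is monotone. *)
Require Import Defs.
From HB Require Import structures.
From mathcomp Require Import all_boot all_order all_algebra.
From mathcomp Require Import all_classical all_reals all_analysis.
From mathcomp Require Import measurable_realfun.
Import Order.TTheory GRing.Theory Num.Theory.
Import numFieldNormedType.Exports.
Local Open Scope classical_set_scope.
Local Open Scope ring_scope.

(** * Reflection of Lebesgue integrals; Borel measurability of [Phi_inv] and [G_t] *)

(** Reflection preserves Lebesgue measure, and an even integrand is unchanged by it, so only the
    domain moves. *)
Lemma Rintegral_oppr (R : realType) (g : R -> R) (A : set R) :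
  measurable A -> (forall x, 0 <= g x) -> measurable_fun setT g ->
  (forall x, g (- x) = g x) ->
  \int[@lebesgue_measure R]_(x in [set x | A (- x)]) g x =
  \int[@lebesgue_measure R]_(x in A) g x.
Proof.
move=> mA g0 mg gN; rewrite /Rintegral; congr fine.
transitivity (\int[pushforward (@lebesgue_measure R)
    (-%R : _ -> measurableTypeR R)]_(x in A) (g x)%:E)%E.
  rewrite ge0_integral_pushforward//=.
  - by apply: eq_integral => x _ /=; rewrite gN.
  - by apply/measurable_EFinP; exact: measurable_funTS.
  - by move=> x _; rewrite lee_fin.
by apply: eq_measure_integral => //= B mB BA; exact: lebesgue_measureN.
Qed.

(** By connectedness the range is an interval, hence Borel. On it the function inverts [h] and
    preimages of rays are traces of rays; off it [xget] returns the default 0. *)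
Lemma measurable_xget_preimage (R : realType) (h : R -> R) :
  continuous h -> {homo h : x y / x < y} ->
  measurable_fun setT (fun p => xget 0 [set x | h x = p]).
Proof.
move=> ch hlt.
have hle : {mono h : x y / x <= y} by exact: le_mono.
have mD : measurable (range h).
  apply: is_interval_measurable; apply/connected_intervalP.
  apply: connected_continuous_connected; last exact: continuous_subspaceT.
  by apply/connected_intervalP.
rewrite -(setUv (range h)); apply/measurable_funU => //.
  exact: measurableC.
have gK x : xget 0 [set y | h y = h x] = x.
  apply: xget_unique => // y /= hyx.
  by apply/eqP; rewrite eq_le -(hle y) -(hle x) hyx lexx.
split.
- apply: (measurability (@RGenCInfty.G R)).
    exact: RGenCInfty.measurableE.
  move=> _ [_ [r ->] <-].
  rewrite (_ : _ `&` _ = range h `&` `[h r, +oo[%classic).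
    exact: measurableI.
  apply/seteqP; split=> p [[x _ <-]] /=; rewrite gK !in_itv/= !andbT => H.
    by split; [exists x|rewrite hle].
  by split; [exists x|rewrite -hle].
- apply: (eq_measurable_fun (cst (0 : R))); last exact: measurable_cst.
  move=> p /[!inE] pD /=; case: xgetP => // x _ /= hxp.
  by exfalso; apply: pD; exists x.
Qed.

Lemma set_ler_itv (R : realType) (x : R) :
  [set u : R | u <= x] = `]-oo, x]%classic.
Proof. by apply/seteqP; split=> u /=; rewrite in_itv. Qed.

Lemma Phi_normalE (R : realType) (x : R) :
  Phi x = \int[@lebesgue_measure R]_(u in `]-oo, x]) normal_pdf 0 1 u.
Proof.
rewrite /Phi set_ler_itv; apply: eq_Rintegral => u _.
rewrite normal_pdfE ?oner_eq0// /normal_peak /normal_fun subr0 expr1n mul1r.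
by rewrite [RHS]mulrC mulr_natl.
Qed.

Lemma Phi_derive (R : realType) (x : R) :
  derivable (@Phi R) x 1 /\ derive1 (@Phi R) x = normal_pdf 0 1 x.
Proof.
have -> : @Phi R = fun x =>
    \int[@lebesgue_measure R]_(u in `]-oo, x]) normal_pdf 0 1 u.
  by apply/funext => y; exact: Phi_normalE.
(* The endpoint [x + 1] only serves to put [x] strictly inside the domain of the fundamental theorem
   of calculus. *)
apply: (@continuous_FTC1 _ _ _ _ (x + 1)).
- by rewrite ltrDl.
- exact: integrableS (integrable_normal_pdf 0 1).
- by rewrite ltNyr.
- exact/continuous_normal_pdf/oner_neq0.
Qed.

Lemma measurable_Phi_inv (R : realType) : measurable_fun setT (@Phi_inv R).
Proof.
have cPhi : continuous (@Phi R).
  move=> x; apply: differentiable_continuous.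
  by apply/derivable1_diffP; case: (Phi_derive R x).
apply: measurable_xget_preimage => // x y xy.
apply: (@gtr0_derive1_lt_cc _ _ x y) => //.
- by move=> z _; case: (Phi_derive R z).
- move=> z _; case: (Phi_derive R z) => _ ->.
  rewrite normal_pdfE ?oner_eq0// mulr_gt0 ?normal_peak_gt0 ?oner_eq0//.
  exact: expR_gt0.
- exact: continuous_subspaceT.
- by rewrite in_itv/= lexx ltW.
- by rewrite in_itv/= lexx ltW.
Qed.

Lemma measurable_G_t (R : realType) (nu : nat) : measurable_fun setT (@G_t R nu).
Proof.
have t0 (u : R) : 0 <= t_kernel nu u by exact: powR_ge0.
have mt : measurable_fun setT (@t_kernel R nu).
  apply: (@measurableT_comp _ _ _ _ _ _ (@powR R ^~ (- ((nu%:R + 1) / 2)))).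
    exact: measurable_powR.
  by apply: measurable_funD => //; apply: measurable_funM.
rewrite /G_t; apply: measurable_funM => //.
(* [fine] is removed first: it sends [+oo] to 0 and could break monotonicity, whereas the
   extended-real integral of a nonnegative kernel grows with its domain. *)
apply: (@measurableT_comp _ _ _ _ _ _ fine) => //.
apply: (measurability (@ErealGenCInfty.G R)).
  exact: ErealGenCInfty.measurableE.
move=> _ [_ [r ->] <-]; rewrite setTI.
apply: is_interval_measurable => x y /= hx hy z /andP[xz zy].
move: hx hy; rewrite !in_itv/= !andbT => hx hy.
apply: (le_trans hx); apply: ge0_subset_integral => //.
- by rewrite set_ler_itv.
- by rewrite set_ler_itv.
- by apply/measurable_EFinP; exact: measurable_funTS.
- by move=> u _; rewrite lee_fin.
- by move=> u /= /le_trans; exact.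
Qed.

Lemma measurable_sqrtr (R : realType) : measurable_fun setT (@Num.sqrt R).
Proof.
by apply: nondecreasing_measurable => // x y; exact: ler_wsqrtr.
Qed.

Lemma measurable_fun_divr_sqrt (R : realType) d (T : measurableType d)
  (f g : T -> R) : measurable_fun setT f -> measurable_fun setT g ->
  measurable_fun setT (fun x => f x / Num.sqrt (g x)).
Proof.
move=> mf mg; apply: measurable_funM => //.
(* Inversion becomes the power -1; the two agree on nonnegative reals, including at 0, where both
   vanish. *)
rewrite (_ : (fun x => _) = (fun x => Num.sqrt (g x) `^ (-1))); last first.
  by apply/funext => x; rewrite powR_inv1// sqrtr_ge0.
apply: (@measurableT_comp _ _ _ _ _ _ (@powR R ^~ (-1))).
  exact: measurable_powR.
by apply: measurableT_comp => //; exact: measurable_sqrtr.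
Qed.

(** * Effect of sign changes on the statistics *)

Definition flip_sign {R : pzRingType} (s : nat -> bool) (x : nat -> R) : nat -> R :=
  fun j => (-1) ^+ s j * x j.

Lemma smean_flip {R : realType} {n : nat} {s : nat -> bool} {x : nat -> R}
  {b : bool} {A : {set 'I_n}} : (forall j : 'I_n, j \in A -> s j = b) ->
  smean (flip_sign s x) A = (-1) ^+ b * smean x A.
Proof.
move=> sA; rewrite /smean mulrA mulr_sumr; congr (_ / _).
by apply: eq_bigr => j jA; rewrite /flip_sign sA.
Qed.

(** The common sign factors out of each deviation from the mean and disappears on squaring. *)
Lemma svar_flip {R : realType} {n : nat} {s : nat -> bool} {x : nat -> R}
  {b : bool} {A : {set 'I_n}} : (forall j : 'I_n, j \in A -> s j = b) ->
  svar (flip_sign s x) A = svar x A.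
Proof.
move=> sA; rewrite /svar (smean_flip sA); congr (_ / _).
apply: eq_bigr => j jA.
by rewrite /flip_sign sA// -mulrBr exprMn sqrr_sign mul1r.
Qed.

(** The signs [s] are chosen before [x], so the swap is induced by one fixed transformation of the
    data. *)
Lemma stat_pair_flip (R : realType) (n : nat) (A : {set 'I_n}) :
  exists s : nat -> bool, forall x : nat -> R,
    stat_pair (flip_sign s x) A = ((stat_pair x A).2, (stat_pair x A).1).
Proof.
have [n2|n2] := boolP (n == 2%N).
  (* The pair ignores the split when n = 2: it is X_1 + X_2, X_1 - X_2 up to
     scale, whatever A is. *)
  exists (pred1 1%N) => x.
  by rewrite /stat_pair n2 /flip_sign /= expr0 expr1 mul1r mulN1r opprK.
(* The sign is -1 exactly on the second block; as [s] lives on [nat], membership goes through an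
   ordinal of value [j]. *)
exists (fun j => [exists i : 'I_n, (val i == j) && (i \notin A)]) => x.
set s := fun j => _.
have sA (i : 'I_n) : s i = (i \notin A).
  apply/existsP/idP => [[k /andP[/eqP/val_inj ->]]//|iA].
  by exists i; rewrite eqxx.
have s1 (i : 'I_n) : i \in A -> s i = false by rewrite sA => ->.
have s2 (i : 'I_n) : i \in ~: A -> s i = true by rewrite sA finset.in_setC.
rewrite /stat_pair (negbTE n2) !(svar_flip s1).
rewrite !(svar_flip s2) (smean_flip s1).
by rewrite (smean_flip s2) expr0 expr1 mul1r mulN1r opprK.
Qed.

(** * Measurability of the statistics for a fixed split *)

Section measurable_statistics.
Context {d} {T : measurableType d} {R : realType} {n : nat} (x : T -> nat -> R)
  (mx : forall j, (j < n)%N -> measurable_fun setT (x ^~ j)).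
Implicit Type A : {set 'I_n}.

Lemma measurable_smean A : measurable_fun setT (fun w => smean (x w) A).
Proof.
apply: measurable_funM => //.
under eq_fun do rewrite big_mkcond/=.
apply: measurable_sum => j; case: (j \in A) => //; exact: mx.
Qed.

Lemma measurable_svar A : measurable_fun setT (fun w => svar (x w) A).
Proof.
apply: measurable_funM => //.
under eq_fun do rewrite big_mkcond/=.
apply: measurable_sum => j; case: (j \in A) => //.
apply: measurable_funX; apply: measurable_funB; last exact: measurable_smean.
exact: mx.
Qed.

Lemma measurable_stat_pair A :
  measurable_fun setT (fun w => (stat_pair (x w) A).1) /\
  measurable_fun setT (fun w => (stat_pair (x w) A).2).
Proof.
rewrite /stat_pair; case: eqP => [n2|_].
  split=> /=; apply: measurable_funM => //.
    by apply: measurable_funD; apply: mx; rewrite n2.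
  by apply: measurable_funB; apply: mx; rewrite n2.
have mV := measurable_funD (measurable_smean A) (measurable_smean (~: A)).
have mV0 := measurable_funB (measurable_smean A) (measurable_smean (~: A)).
have mG (h : T -> R) : measurable_fun setT h ->
    measurable_fun setT (fun w => Phi_inv (G_t (n - 2) (h w))).
  move=> mh; apply: measurableT_comp; first exact: measurable_Phi_inv.
  by apply: measurableT_comp => //; exact: measurable_G_t.
case: eqP => _ /=; split; apply/mG/measurable_fun_divr_sqrt => //.
- exact: measurable_svar.
- exact: measurable_svar.
- apply: measurable_funM => //; apply: measurable_funM => //.
  by apply: measurable_funD; apply: measurable_funM => //; exact: measurable_svar.
- apply: measurable_funM => //; apply: measurable_funM => //.
  by apply: measurable_funD; apply: measurable_funM => //; exact: measurable_svar.
Qed.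

End measurable_statistics.

(** * The sigma-algebra of the data *)

Section finite_rectangles.
Context {R : realType} {m : nat} (n : 'I_m -> nat).

(** Only coordinates [j < n k] are constrained, so the generated sigma-algebra sees just the genuine
    observations. *)
Definition rectangles : set (set ('I_m -> nat -> R)) :=
  [set D | exists2 B : 'I_m -> nat -> set R, forall k j, measurable (B k j) &
    D = data_rect n (fun k j y => y k j) xpredT B].

Lemma rectangles_setI : setI_closed rectangles.
Proof.
move=> _ _ [B mB ->] [C mC ->].
exists (fun k j => B k j `&` C k j) => [k j|]; first exact: measurableI.
apply/seteqP; split=> y /= => [[yB yC] k j _ jn|yBC].
  by split; [exact: yB|exact: yC].
by split=> k j _ jn; case: (yBC k j isT jn).
Qed.

Lemma rectangles_setT : rectangles setT.
Proof. by exists (fun _ _ => setT) => //; apply/seteqP; split. Qed.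

Local Notation data_space := (g_sigma_algebraType rectangles).

Lemma measurable_coordinate (k : 'I_m) (j : nat) : (j < n k)%N ->
  measurable_fun setT (fun y : data_space => y k j).
Proof.
move=> jn _ A mA; rewrite setTI; apply: sub_sigma_algebra.
exists (fun k' j' => if (k' == k) && (j' == j) then A else setT) => [k' j'|].
  by case: ifP.
apply/seteqP; split=> y /= => [Ay k' j' _ _|/(_ k j isT jn)]; last by rewrite !eqxx.
by case: ifP => // /andP[/eqP -> /eqP ->].
Qed.

Context {d} {T : measurableType d} (X : 'I_m -> nat -> T -> R)
  (mX : forall k j, measurable_fun setT (X k j)).

Lemma measurable_data_rect (keep : pred 'I_m) (B : 'I_m -> nat -> set R) :
  (forall k j, measurable (B k j)) -> measurable (data_rect n X keep B).
Proof.
move=> mB.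
rewrite (_ : data_rect _ _ _ _ = \bigcap_(k in [set: 'I_m]) \bigcap_j
    (if keep k && (j < n k)%N then X k j @^-1` B k j else setT)).
  apply: fin_bigcap_measurable => // k _; apply: bigcapT_measurable => j.
  by case: ifP => // _; rewrite -[X in measurable X]setTI; exact: mX.
apply/seteqP; split=> w /= => [wB k _ j _|wB k j kk jn].
  by case: ifP => // /andP[kk jn]; exact: wB.
by have := wB k I j I; rewrite kk jn.
Qed.

Lemma measurable_data (D : set data_space) : measurable D ->
  measurable [set w | D (fun k j => X k j w)].
Proof.
move=> mD.
have : measurable_fun setT (fun w => (fun k j => X k j w) : data_space).
  apply: (@measurability _ _ T data_space setT _ rectangles) => // _ [_ [B mB ->] <-].
  by rewrite setTI; exact: (measurable_data_rect xpredT).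
by move=> /(_ measurableT _ mD); rewrite setTI.
Qed.

End finite_rectangles.

(** * Equality of laws from rectangles and fibers; sign invariance under the null *)

(** Dynkin's pi-lambda argument; complements are handled by subtraction from the common mass [P E].
    The event [E] will be one that fixes the splits. *)
Lemma eq_rectangles_law {R : realType} {m : nat} {n : 'I_m -> nat}
  {d} {T : measurableType d} (P : probability T R)
  (X Y : 'I_m -> nat -> T -> R) (E : set T) :
  (forall k j, measurable_fun setT (X k j)) ->
  (forall k j, measurable_fun setT (Y k j)) -> measurable E ->
  (forall B : 'I_m -> nat -> set R, (forall k j, measurable (B k j)) ->
    P (E `&` data_rect n X xpredT B) = P (E `&` data_rect n Y xpredT B)) ->
  forall D : set (g_sigma_algebraType (rectangles n)), measurable D ->
    P (E `&` [set w | D (fun k j => X k j w)]) =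
    P (E `&` [set w | D (fun k j => Y k j w)]).
Proof.
move=> mX mY mE XY D.
apply: (@dynkin_induction _ (g_sigma_algebraType (rectangles n)) (rectangles n)
    (fun D => P (E `&` [set w | D (fun k j => X k j w)]) =
              P (E `&` [set w | D (fun k j => Y k j w)]))) => //.
- exact: rectangles_setI.
- by move=> _ [B mB ->]; exact: XY.
- move=> S mS IH.
  have PC (Z : 'I_m -> nat -> T -> R) : (forall k j, measurable_fun setT (Z k j)) ->
      P (E `&` [set w | (~` S) (fun k j => Z k j w)]) =
      (P E - P (E `&` [set w | S (fun k j => Z k j w)]))%E.
    move=> mZ; rewrite -measureD//; first exact: measurable_data.
    exact: le_lt_trans (probability_le1 P mE) (ltry _).
  by rewrite !PC// IH.
- move=> F mF tF IH.
  have PU (Z : 'I_m -> nat -> T -> R) : (forall k j, measurable_fun setT (Z k j)) ->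
      P (E `&` [set w | (\bigcup_k F k) (fun k j => Z k j w)]) =
      (\sum_(0 <= i <oo) P (E `&` [set w | F i (fun k j => Z k j w)]))%E.
    move=> mZ; rewrite -measure_semi_bigcup//.
    + by congr (P _); rewrite setI_bigcupr.
    + by move=> i; apply: measurableI => //; exact: measurable_data.
    + move=> i j _ _ [w [[_ wi] [_ wj]]]; apply: tF => //.
      by exists (fun k l => Z k l w).
    + apply: bigcup_measurable => i _.
      by apply: measurableI => //; exact: measurable_data.
  by rewrite !PU//; congr (limn _); apply/funext => N; apply: eq_bigr.
Qed.

Lemma measure_eq_fibers {R : realType} {d} {T : measurableType d}
  (P : {measure set T -> \bar R}) (F : finType) (N : T -> F) (E E' : set T) :
  (forall a, measurable ([set w | N w = a] `&` E)) ->
  (forall a, measurable ([set w | N w = a] `&` E')) ->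
  (forall a, P ([set w | N w = a] `&` E) = P ([set w | N w = a] `&` E')) ->
  P E = P E'.
Proof.
move=> mE mE' EE'.
have PE (H : set T) : (forall a, measurable ([set w | N w = a] `&` H)) ->
    P H = (\sum_(a \in [set: F]) P ([set w | N w = a] `&` H))%E.
  move=> mH; rewrite -measure_fin_bigcup//.
  - congr (P _); apply/seteqP; split=> [w Hw|w [a _ []//]].
    by exists (N w).
  - exact: finite_finset.
  - by move=> a b _ _ [w [[<- _] [<- _]]].
by rewrite (PE E)// (PE E')//; apply: eq_fsbigr => a _.
Qed.

(** Flipping signs reflects some sides of the rectangle of unit [i]. Each factor of the conditional
    product is unchanged because [g] is even, and the domain of the outer integral involves the
    other units only. *)
Lemma null_flip_rectangle {R : realType} {d} {T : measurableType d}
  (P : probability T R) {m : nat} (n : 'I_m -> nat) (X : 'I_m -> nat -> T -> R)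
  (i : 'I_m) (g : R -> T -> R) (s : nat -> bool) :
  (forall w x, 0 <= g x w) -> (forall w, measurable_fun setT (g ^~ w)) ->
  (forall w x, g (- x) w = g x w) ->
  (forall (A : nat -> set R) (B : 'I_m -> nat -> set R),
     (forall j, measurable (A j)) -> (forall k j, measurable (B k j)) ->
     P ([set w | forall j, (j < n i)%N -> A j (X i j w)] `&`
        data_rect n X (fun k => k != i) B) =
     (\int[P]_(w in data_rect n X (fun k => k != i) B)
        (\prod_(j < n i) \int[@lebesgue_measure R]_(x in A j) g x w)%:E)%E) ->
  forall B : 'I_m -> nat -> set R, (forall k j, measurable (B k j)) ->
    P (data_rect n (fun k j w => (-1) ^+ ((k == i) && s j) * X k j w) xpredT B) =
    P (data_rect n X xpredT B).
Proof.
move=> g0 mg gN lawX B mB.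
pose A j := if s j then [set x | B i j (- x)] else B i j.
have mA j : measurable (A j).
  rewrite /A; case: (s j) => //.
  by rewrite -[X in measurable X]setTI; exact: (@oppr_measurable R setT).
rewrite (_ : data_rect n _ xpredT B =
    [set w | forall j, (j < n i)%N -> A j (X i j w)] `&`
    data_rect n X (fun k => k != i) B); last first.
  apply/seteqP; split=> w /= => [wB|[wA wB] k j _ jn].
    split=> [j jn|k j ki jn].
      have := wB i j isT jn; rewrite eqxx /A /=.
      by case: (s j); rewrite ?expr1 ?expr0 ?mulN1r ?mul1r.
    by have := wB k j isT jn; rewrite (negbTE ki) expr0 mul1r.
  have [ki|ki] := eqVneq k i; last by rewrite expr0 mul1r; exact: wB.
  rewrite ki in jn *; have := wA j jn; rewrite /A /=.
  by case: (s j); rewrite ?expr1 ?expr0 ?mulN1r ?mul1r.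
rewrite (_ : data_rect n X xpredT B =
    [set w | forall j, (j < n i)%N -> B i j (X i j w)] `&`
    data_rect n X (fun k => k != i) B); last first.
  apply/seteqP; split=> w /= => [wB|[wA wB] k j _ jn].
    by split=> [j jn|k j ki jn]; exact: wB.
  have [ki|ki] := eqVneq k i; last exact: wB.
  by rewrite ki in jn *; exact: wA.
rewrite (lawX A B mA mB) (lawX (B i) B (mB i) mB).
apply: eq_integral => w _; congr EFin.
apply: eq_bigr => j _; rewrite /A; case: (s j) => //.
exact: Rintegral_oppr.
Qed.

(** * Exchangeability, one value of the splits at a time *)

Theorem theorem1
  (R : realType) (d : measure_display) (Omega : measurableType d)
  (P : probability Omega R)
  (m : nat) (n : 'I_m -> nat) (mu : 'I_m -> R)
  (eps : 'I_m -> nat -> Omega -> R)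
  (N1 : forall i : 'I_m, Omega -> {set 'I_(n i)})
  (f : 'I_m -> R -> ('I_m -> nat -> R) -> R) :
  (* m >= 1 and n_i >= 2 *)
  (0 < m)%N ->
  (forall i, (2 <= n i)%N) ->
  (* the errors are random variables with E(eps_ij) = 0 *)
  (forall i j, measurable_fun setT (eps i j)) ->
  (forall i j, (j < n i)%N ->
     P.-integrable setT (EFin \o eps i j) /\ ('E_P[eps i j] = 0)%E) ->
  (* random split of [n_i] into N_i1 (size ceil(n_i/2)) and its complement *)
  (forall i w, #|N1 i w| = uphalf (n i)) ->
  (forall i (A : {set 'I_(n i)}), measurable [set w | N1 i w = A]) ->
  (* the splits are drawn independently of the data *)
  (forall (pi : forall i : 'I_m, {set 'I_(n i)}) (B : 'I_m -> nat -> set R),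
     (forall k j, measurable (B k j)) ->
     P ([set w | forall i, N1 i w = pi i] `&`
        data_rect n (Xobs mu eps) xpredT B) =
     (P [set w | forall i, N1 i w = pi i] *
      P (data_rect n (Xobs mu eps) xpredT B))%E) ->
  (* for i in H_0: f_i(. | y) is a probability density, depending on y only
     through the other units' observations, symmetric about 0 *)
  (forall i, mu i = 0 -> forall y,
     (forall x, 0 <= f i x y) /\
     measurable_fun setT (fun x => f i x y) /\
     (\int[@lebesgue_measure R]_x (f i x y)%:E = 1)%E) ->
  (forall i, mu i = 0 -> forall x y y',
     (forall k j, k != i -> (j < n k)%N -> y k j = y' k j) ->
     f i x y = f i x y') ->
  (forall i, mu i = 0 -> forall x y, f i (- x) y = f i x y) ->
  (* for i in H_0: conditionally on X_{-i}, eps_i1, ..., eps_in_i are i.i.d.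
     with conditional density f_i(. | X_{-i}) *)
  (forall i, mu i = 0 ->
     forall (A : nat -> set R) (B : 'I_m -> nat -> set R),
     (forall j, measurable (A j)) -> (forall k j, measurable (B k j)) ->
     P ([set w | forall j, (j < n i)%N -> A j (eps i j w)] `&`
        data_rect n (Xobs mu eps) (fun k => k != i) B) =
     (\int[P]_(w in data_rect n (Xobs mu eps) (fun k => k != i) B)
        (\prod_(j < n i)
           \int[@lebesgue_measure R]_(x in A j)
              f i x (fun k l => Xobs mu eps k l w))%:E)%E) ->
  (* conclusion: pairwise exchangeability under the null *)
  forall i, mu i = 0 ->
    cond_eq_dist P
      (Tst mu eps N1 i) (T0st mu eps N1 i)
      (T0st mu eps N1 i) (Tst mu eps N1 i)
      (cond_family (Tst mu eps N1) (T0st mu eps N1) i).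
Proof.
move=> _ n2 meps _ _ mN1 indep fdens fdep fsym law i mui0 A1 A2 B mA1 mA2 mB.
pose X := Xobs mu eps.
have mX k j : measurable_fun setT (X k j) by exact: measurable_funD.
(* All splits form a single variable with values in a finite type, so there are finitely many
   fibers. *)
pose F := {dffun forall k : 'I_m, {set 'I_(n k)}}.
pose N (w : Omega) : F := [ffun k => N1 k w].
have NE (a : F) : [set w | N w = a] = [set w | forall k, N1 k w = a k].
  apply/seteqP; split=> w /= => [<- k|wa]; first by rewrite ffunE.
  by apply/ffunP => k; rewrite ffunE.
have mN (a : F) : measurable [set w | N w = a].
  rewrite NE (_ : [set w | _] = \bigcap_(k in [set: 'I_m]) [set w | N1 k w = a k]).
    exact: fin_bigcap_measurable.
  by apply/seteqP; split=> w /= wa k; [move=> _; exact: wa|exact: wa].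
(* With the splits frozen at [a], the statistics become functions of the data alone. *)
pose st (k : 'I_m) (b : bool) (a : F) (y : g_sigma_algebraType (rectangles n)) : R :=
  let p := stat_pair (y k) (a k) in if b then p.1 else p.2.
have mst k b a : measurable_fun setT (st k b a).
  have [] := @measurable_stat_pair _ (g_sigma_algebraType (rectangles n)) R
    (n k) (fun y => y k) (measurable_coordinate n k) (a k).
  by case: b.
(* [b = true] encodes the original order of the pair of unit [i], [b = false] the swapped one. *)
pose D (a : F) b := st i b a @^-1` A1 `&` (st i (~~ b) a @^-1` A2 `&`
  \bigcap_kb st (val kb.1) kb.2 a @^-1` B kb).
have mD a b : measurable (D a b).
  have mpre k c A : measurable A -> measurable (st k c a @^-1` A).
    by move=> mA; rewrite -[X in measurable X]setTI; exact: mst.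
  apply: measurableI; first exact: mpre.
  apply: measurableI; first exact: mpre.
  apply: fin_bigcap_measurable => [|kb _]; first exact: finite_finset.
  exact: mpre.
have TE (a : F) b : [set w | N w = a] `&`
      [set w | A1 ((if b then Tst else T0st) R Omega m n mu eps N1 i w) /\
        A2 ((if b then T0st else Tst) R Omega m n mu eps N1 i w) /\
        forall k, B k (cond_family (Tst mu eps N1) (T0st mu eps N1) i k w)] =
    [set w | N w = a] `&` [set w | D a b (fun k j => X k j w)].
  apply/seteqP; split=> w /= [<-].
    rewrite /D /st /= => -[+ [+ wB]].
    rewrite /N !ffunE; case: b => /= w1 w2; split=> //; split=> //; split=> //.
    - move=> [k []] _ /=; rewrite ffunE; first exact: (wB (k, true)).
      exact: (wB (k, false)).
    - move=> [k []] _ /=; rewrite ffunE; first exact: (wB (k, true)).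
      exact: (wB (k, false)).
  rewrite /D /st /N /= !ffunE => -[w1 [w2 wB]].
  split=> //; case: b w1 w2 => /= w1 w2; split=> //; split=> // -[k b'].
    by have := wB (k, b') I; rewrite /= ffunE /cond_family; case: b'.
  by have := wB (k, b') I; rewrite /= ffunE /cond_family; case: b'.
have mTE a b : measurable ([set w | N w = a] `&` [set w | D a b (fun k j => X k j w)]).
  by apply: measurableI => //; exact: (measurable_data n X mX).
apply: (measure_eq_fibers P F N) => a.
- by rewrite (TE a true).
- by rewrite (TE a false).
rewrite (TE a true) (TE a false).
have [s flipE] := stat_pair_flip R (n i) (a i).
pose X' k j w : R := (-1) ^+ ((k == i) && s j) * X k j w.
have mX' k j : measurable_fun setT (X' k j) by exact: measurable_funM.
have X'i w : (fun j => X' i j w) = flip_sign s (fun j => X i j w).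
  by apply/funext => j; rewrite /X' eqxx.
have X'k k w : k != i -> (fun j => X' k j w) = (fun j => X k j w).
  by move=> ki; apply/funext => j; rewrite /X' (negbTE ki) expr0 mul1r.
have sti b w : st i b a (fun k j => X' k j w) = st i (~~ b) a (fun k j => X k j w).
  by rewrite /st X'i flipE; case: b.
have stk k b w : k != i ->
    st k b a (fun k j => X' k j w) = st k b a (fun k j => X k j w).
  by move=> ki; rewrite /st X'k.
(* The swapped event for the data is the original event for the sign-changed data, which reduces the
   goal to comparing the laws of [X] and [X']. *)
have -> : [set w | D a false (fun k j => X k j w)] =
    [set w | D a true (fun k j => X' k j w)].
  apply/seteqP; split=> w [w1 [w2 wB]].
    split; first exact: (eq_ind_r A1 w1 (sti true w)).
    split; first exact: (eq_ind_r A2 w2 (sti false w)).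
    move=> kb _; apply: (eq_ind_r (B kb) (wB kb I)).
    exact: stk (valP kb.1).
  split; first exact: (eq_ind _ A1 w1 _ (sti true w)).
  split; first exact: (eq_ind _ A2 w2 _ (sti false w)).
  move=> kb _; apply: (eq_ind _ (B kb) (wB kb I)).
  exact: stk (valP kb.1).
apply: (eq_rectangles_law P X X' [set w | N w = a]) => // B' mB'.
have indepN C : (forall k j, measurable (C k j)) ->
    P ([set w | N w = a] `&` data_rect n X xpredT C) =
    (P [set w | N w = a] * P (data_rect n X xpredT C))%E.
  by move=> mC; rewrite NE; exact: indep.
(* Independence is assumed for rectangles in [X]; reflecting the sides turns a rectangle in [X']
   into one of these. *)
pose C k j := if (k == i) && s j then [set x | B' k j (- x)] else B' k j.
have mC k j : measurable (C k j).
  rewrite /C; case: ifP => // _.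
  by rewrite -[X in measurable X]setTI; exact: (@oppr_measurable R setT).
have X'C : data_rect n X' xpredT B' = data_rect n X xpredT C.
  apply/seteqP; split=> w /= wB k j _ jn; have := wB k j isT jn;
  by rewrite /X' /C /=; case: (_ && _); rewrite ?expr0 ?expr1 ?mulN1r ?mul1r.
rewrite X'C !indepN// -X'C; congr (_ * _)%E; apply/esym.
pose g x w := f i x (fun k l => X k l w).
apply: (null_flip_rectangle P n X i g) => //.
- by move=> w x; exact: (fdens i mui0 _).1.
- by move=> w; exact: (fdens i mui0 _).2.1.
- by move=> w x; exact: fsym.
(* Since [mu i = 0], the observations of unit [i] are its errors, whose conditional law is the one
   assumed. *)
move=> A C' mA mC'; rewrite -law//; congr (P (_ `&` _)).
by apply/seteqP; split=> w /= wA j jn; have := wA j jn; rewrite /X /Xobs mui0 add0r.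
Qed.
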